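(* Let $p$ be a prime. For $k\ge 1$ let $W_k:=C_p\wr C_{p^k}$ and $G_k:=C_p\wr W_k$. Then for every $k\ge1$ $$\frac{|\{g^p\mid g\in G_k\}|}{|G_k|}\le p^{-(p-1)p^{p^k-1}},$$ and consequently the proportion of elements of $G_k$ that are $p$-th powers tends to zero as $k\to\infty$.
   Context: $C_n$ denotes the cyclic group of order $n$. For a finite group $G$, $C_p\wr G$ is the wreath product with respect to the regular action of $G$ on itself by left multiplication, i.e. $C_p\wr G=\mathbb F_p[G]\rtimes G$, where $G$ acts on the group algebra $\mathbb F_p[G]$ (as an additive group) by left multiplication. *)

(* Defs.v *)
From HB Require Import structures.
From mathcomp Require Import all_boot all_order all_algebra all_fingroup.
From mathcomp Require Import reals.
Import GRing.Theory.

Set Implicit Arguments.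
Unset Strict Implicit.
Unset Printing Implicit Defensive.

Section WreathProduct.
Variables (p : nat) (gT : finGroupType).
Local Open Scope group_scope.

(* The additive group of F_p[gT]; f : {ffun gT -> 'F_p} stands for the formal
   sum of the f x * x, over x in gT. *)
Definition grpalg : predArgType := {ffun gT -> 'F_p}.
HB.instance Definition _ := GRing.Zmodule.on grpalg.
HB.instance Definition _ := Finite.on grpalg.

(* Left multiplication by a maps the sum of the f x * x to that of the
   f x * (a x), whose coefficient at y is f (a^-1 y). *)
Definition grpalg_lmul (a : gT) (f : grpalg) : grpalg :=
  [ffun y => f (a^-1 * y)].

(* MathComp actions are on the right, so that f ^ a = a^-1 * (f * a) in a
   semidirect product; the right action matching left multiplication
   a f a^-1 = a . f is therefore (f, a) |-> a^-1 . f. *)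
Definition grpalg_act (f : grpalg) (a : gT) : grpalg := grpalg_lmul a^-1 f.

Fact grpalg_act_is_action : is_action [set: gT] grpalg_act.
Proof.
apply: is_total_action => [f | f a b]; apply/ffunP => y; rewrite !ffunE !invgK.
  by rewrite mul1g.
by rewrite mulgA.
Qed.

Canonical grpalg_action := Action grpalg_act_is_action.

Fact grpalg_act_is_groupAction :
  is_groupAction [set: (grpalg : finZmodType)] grpalg_action.
Proof.
move=> a _; rewrite inE; apply/andP; split.
  by apply/subsetP=> f _; rewrite inE.
apply/morphicP=> f g _ _; rewrite !actpermE.
by apply/ffunP=> y; rewrite !(ffunE, FinRing.zmodMgE).
Qed.

Canonical grpalg_groupAction := GroupAction grpalg_act_is_groupAction.

Definition wreath : finGroupType := sdprod_by grpalg_groupAction.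

End WreathProduct.

(* 'Z_n has order n only for n >= 2, and 'F_p has order p only for p prime;
   this covers n = p ^ k with p prime and
   k >= 1, while for k = 0 the type 'Z_(p ^ k) has two elements. *)
Definition W (p k : nat) : finGroupType := wreath p 'Z_(p ^ k).

Definition G (p k : nat) : finGroupType := wreath p (W p k).

Definition pthpowers (p : nat) (gT : finGroupType) : {set gT} :=
  [set g ^+ p | g : gT]%g.

Definition pthpower_proportion (R : realType) (p : nat) (gT : finGroupType) : R :=
  (#|pthpowers p gT|%:R / #|gT|%:R)%R.

(* Main.v *)
Require Import Defs.
From mathcomp Require Import all_classical all_reals all_analysis.
From mathcomp Require Import all_boot all_order all_algebra all_fingroup cyclic.
Import Order.TTheory GRing.Theory Num.Theory numFieldNormedType.Exports.

(** In the wreath product of C_p by a finite group H, the p-th power of (w, f) is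
(w^p, N f) with N = 1 + w + ... + w^(p-1), and N = T^(p-1) for T = 1 - w because
the characteristic is p. If H has exponent m = p^e, then T^m = 1 - w^m = 0. Since
the groups ker T /\ im T^i decrease with i, the orders of the successive quotients
im T^i / im T^(i+1) do too, so that |im T^j|^m <= |F_p[H]|^(m-j); take j = p - 1 and
sum over w. For H = W_k the exponent divides p^(k+1). *)

Set Implicit Arguments.
Unset Strict Implicit.
Unset Printing Implicit Defensive.

(** * Images of the iterates of a nilpotent endomorphism *)

(** The value [c j] separates the two ranges: the head [P] is at least [c j ^ j] and the tail [A] at
    most [c j ^ (m - j)], whence [A ^ j <= P ^ (m - j)]; multiply by [A ^ (m - j)]. *)
Lemma prod_nonincreasing_tail (c : nat -> nat) (j m : nat) : j <= m ->
    {homo c : i l / i <= l >-> l <= i} ->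
  (\prod_(j <= i < m) c i) ^ m <= (\prod_(0 <= i < m) c i) ^ (m - j).
Proof.
move=> jm c_mono; rewrite [X in _ <= X ^ _](big_cat_nat (n := j)) //=.
set P := \prod_(0 <= i < j) c i; set A := \prod_(j <= i < m) c i.
have expS n a b : a <= b -> a ^ n <= b ^ n by case: n => // n; rewrite leq_exp2r.
have leP : c j ^ j <= P.
  rewrite -[X in c j ^ X]subn0 -prod_nat_const_nat big_seq [P]big_seq leq_prod //.
  by move=> i; rewrite mem_index_iota => /andP[_ /ltnW]; apply: c_mono.
have leA : A <= c j ^ (m - j).
  rewrite -prod_nat_const_nat big_seq [A]big_seq leq_prod // => i.
  by rewrite mem_index_iota => /andP[+ _]; apply: c_mono.
rewrite -{1}(subnK jm) expnD expnMn mulnC; apply: leq_mul => //.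
by apply: leq_trans (expS j _ _ leA) _; rewrite -expnM mulnC expnM expS.
Qed.

Section IterMorphim.
Variables (gT : finGroupType) (f : {morphism [set: gT] >-> gT}).
Local Open Scope group_scope.

Let I i : {group gT} := iter i (fun A : {group gT} => (f @* A)%G) [set: gT]%G.

Lemma iter_imset_morphim i : iter i f @: [set: gT] = I i :> {set gT}.
Proof.
elim: i => [|i IH] /=; first exact: imset_id.
by rewrite morphimEsub ?subsetT //= -IH -imset_comp.
Qed.

Lemma card_iter_imset_morphism (j m : nat) : (j <= m)%N ->
    (forall x, iter m f x = 1) ->
  (#|iter j f @: [set: gT]| ^ m <= #|gT| ^ (m - j))%N.
Proof.
move=> jm fm1; pose c i := #|'ker f :&: I i|.
have I_antimono i l : (i <= l)%N -> I l \subset I i.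
  move=> /subnK <-; elim: (l - i)%N => [|d]; first exact: subxx.
  suff S n : I n.+1 \subset I n by rewrite addSn; apply: subset_trans.
  by elim: n => [|n /(morphimS f)]; [apply: subsetT|].
(* First isomorphism theorem for [f] restricted to [I i]; as [I m] is trivial, the order of [I i]
   becomes the product of the [c l] for [i <= l < m]. *)
have cardI i : #|I i| = (c i * #|I i.+1|)%N.
  by rewrite [#|I i.+1|]card_morphim setTI /c setIC (LagrangeI (I i) ('ker f)%G).
have cardItail i : (i <= m)%N -> #|I i| = (\prod_(i <= l < m) c l)%N.
  have Im1 : #|I m| = 1%N.
    apply/eqP; rewrite -trivg_card1 -subG1 /= -iter_imset_morphim.
    by apply/subsetP=> _ /imsetP[x _ ->]; rewrite inE fm1.
  move=> im; rewrite -(subKn im); elim: (m - i)%N (leq_subr i m) => [|d IH] dm.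
    by rewrite subn0 big_geq.
  rewrite (cardI (m - d.+1)%N) big_ltn; last by rewrite ltn_subrL (leq_trans _ dm).
  by rewrite subnSK // IH // ltnW.
have := @prod_nonincreasing_tail c j m jm.
rewrite -!cardItail // iter_imset_morphim /= cardsT; apply=> i l il.
exact/subset_leq_card/setIS/I_antimono.
Qed.

End IterMorphim.

Lemma card_iter_imset_additive (V : finZmodType) (T : V -> V) (j m : nat) :
    {morph T : x y / x + y}%R -> j <= m -> (forall x, iter m T x = 0%R) ->
  #|iter j T @: [set: V]| ^ m <= #|V| ^ (m - j).
Proof.
move=> TD; have TM : {in [set: V] &, {morph T : x y / x * y}}%g.
  by move=> x y _ _; apply: TD.
exact: (@card_iter_imset_morphism V (@Morphism V V _ T TM)).
Qed.

(** * The operator 1 - w on the group algebra *)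

Section GroupAlgebra.
Variables (p : nat) (gT : finGroupType).
Local Open Scope ring_scope.
Hypothesis p_prime : prime p.
Implicit Types (w : gT) (f : grpalg p gT).

(** The operator T = 1 - w, where w acts through [grpalg_act], that is, as left multiplication by
    w^-1. *)
Definition grpalg_actB w f : grpalg p gT := f - grpalg_act f w.

Lemma grpalg_actE f w y : grpalg_act f w y = f (w * y)%g.
Proof. by rewrite ffunE invgK. Qed.

Lemma grpalg_actBE w f y : grpalg_actB w f y = f y - f (w * y)%g.
Proof. by rewrite !ffunE invgK. Qed.

(** Binomial expansion of (1 - w)^n, by induction with Pascal's rule. *)
Lemma iter_grpalg_actBE w n f y :
  iter n (grpalg_actB w) f y =
    \sum_(i < n.+1) (-1) ^+ i * f (w ^+ i * y)%g *+ 'C(n, i).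
Proof.
elim: n y => [|n IHn] y /=; first by rewrite big_ord1 mul1r mul1g.
rewrite grpalg_actBE !IHn big_ord_recl [RHS]big_ord_recl -addrA !bin0.
congr (_ + _) => /=.
rewrite -sumrN; under [RHS]eq_bigr do rewrite binS mulrnDr.
rewrite big_split /= [X in _ = X + _]big_ord_recr /= bin_small // mulr0n addr0.
congr (_ + _).
by apply: eq_bigr => i _; rewrite exprS mulN1r mulNr mulNrn expgSr mulgA.
Qed.

(** By Pascal's rule, consecutive coefficients add up to ['C(p, i.+1)], which p divides. *)
Lemma bin_pred_prime i : (i < p)%N -> ('C(p.-1, i))%:R = (-1) ^+ i :> 'F_p.
Proof.
elim: i => [|i IHi] ip; first by rewrite bin0.
have : (p %| 'C(p.-1.+1, i.+1))%N by rewrite prednK ?prime_gt0 ?prime_dvd_bin.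
rewrite (dvdn_pcharf (pchar_Fp p_prime)) binS natrD IHi; last exact: ltnW.
by rewrite addr_eq0 exprS mulN1r => /eqP.
Qed.

Lemma iter_grpalg_actB_pred w f :
  iter p.-1 (grpalg_actB w) f = \sum_(i < p) grpalg_act f (w ^+ i)%g.
Proof.
apply/ffunP=> y; rewrite iter_grpalg_actBE sum_ffunE prednK ?prime_gt0 //.
apply: eq_bigr => i _; rewrite grpalg_actE -mulr_natr bin_pred_prime // mulrAC.
by rewrite -expr2 sqrr_sign mul1r.
Qed.

Lemma iter_grpalg_actB_prime w f :
  iter p (grpalg_actB w) f = grpalg_actB (w ^+ p)%g f.
Proof.
have -> : iter p (grpalg_actB w) f = iter p.-1.+1 (grpalg_actB w) f.
  by rewrite prednK ?prime_gt0.
rewrite iterS iter_grpalg_actB_pred.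
apply/ffunP=> y; rewrite !grpalg_actBE !sum_ffunE -sumrB.
(* (1 - w)(1 + w + ... + w^(p-1)) telescopes to 1 - w^p. *)
pose F i := f (w ^+ i * y)%g; rewrite -[RHS]opprB.
rewrite -[X in _ - f X]mul1g -/(F 0) -/(F p) -(telescope_sumr F (leq0n p)).
rewrite big_mkord -sumrN; apply: eq_bigr => i _.
by rewrite !grpalg_actE mulgA -expgSr opprB.
Qed.

Lemma iter_grpalg_actB_primeX w e f :
  iter (p ^ e) (grpalg_actB w) f = grpalg_actB (w ^+ (p ^ e))%g f.
Proof.
elim: e => [|e IHe] in w f *; first by [].
(* Group the iterations into [p ^ e] blocks of p, each of which is 1 - w^p. *)
rewrite expnS expgM -IHe mulnC; elim: (p ^ e)%N => [|n IHn] //=.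
by rewrite mulSn iterD IHn iter_grpalg_actB_prime.
Qed.

Lemma grpalg_actBD w : {morph grpalg_actB w : f g / f + g}.
Proof.
by move=> f g; apply/ffunP=> y;
  rewrite grpalg_actBE [RHS]ffunE !grpalg_actBE !ffunE opprD addrACA.
Qed.

(** Put m = p^e. The sum is T^(p-1) f and T^m = 0, so the m-th power of the cardinality is at most
    p^(mq(m - (p-1))); then take m-th roots. *)
Lemma card_sum_grpalg_act w e q : #|gT| = (p ^ e * q)%N ->
    (w ^+ (p ^ e) = 1)%g -> (p.-1 <= p ^ e)%N ->
  (#|[set (\sum_(i < p) grpalg_act f (w ^+ i)%g)%R
               | f in [set: grpalg p gT]]|
    <= p ^ (q * (p ^ e - p.-1)))%N.
Proof.
move=> cardG we1 pe.
rewrite -(@leq_exp2r _ _ (p ^ e)) ?expn_gt0 ?prime_gt0 //.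
under eq_imset do rewrite -iter_grpalg_actB_pred.
have := card_iter_imset_additive (grpalg_actBD w) pe.
rewrite card_ffun card_Fp // cardG -!expnM => H.
apply: leq_trans (H _) _; last by rewrite -mulnA [X in (_ ^ X <= _)%N]mulnC.
move=> f; rewrite iter_grpalg_actB_primeX we1.
by apply/ffunP=> y; rewrite grpalg_actBE mul1g subrr ffunE.
Qed.

End GroupAlgebra.

(** * Counting p-th powers in a wreath product *)

Section Wreath.
Variables (p : nat) (gT : finGroupType).
Hypothesis p_prime : prime p.
Implicit Type u : wreath p gT.

Lemma wreath_expE u n :
  val (u ^+ n)%g =
    ((val u).1 ^+ n, \sum_(i < n) grpalg_act (val u).2 ((val u).1 ^+ i))%g%R.
Proof.
elim: n => [|n IHn]; first by rewrite big_ord0.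
rewrite expgS big_ord_recr /= addrC [in RHS]expgS.
by rewrite -[LHS]/((val u).1 * (val (u ^+ n)).1,
  grpalg_act (val u).2 (val (u ^+ n)).1 + (val (u ^+ n)).2)%g%R IHn.
Qed.

Lemma card_wreath : #|wreath p gT| = (#|gT| * p ^ #|gT|)%N.
Proof.
rewrite card_sub (@eq_card _ _ (mem {: gT * grpalg p gT})) => [|x].
  by rewrite card_prod card_ffun card_Fp.
by rewrite !inE.
Qed.

(** For fixed w the p-th powers of the (w, f) are the (w^p, N f), so their number is at most that of
    the values of N; a union bound over w concludes. *)
Lemma card_pthpowers_wreath e q : #|gT| = (p ^ e * q)%N ->
    (forall w : gT, w ^+ (p ^ e) = 1)%g -> (p.-1 <= p ^ e)%N ->
  (#|pthpowers p (wreath p gT)| <= #|gT| * p ^ (q * (p ^ e - p.-1)))%N.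
Proof.
move=> cardG expG pe; rewrite -(card_imset _ val_inj).
pose N w := [set (\sum_(i < p) grpalg_act f (w ^+ i)%g)%R
               | f in [set: grpalg p gT]].
have sub : val @: pthpowers p (wreath p gT) \subset
    \bigcup_(w : gT) [set (w ^+ p, h)%g | h in N w].
  apply/subsetP=> _ /imsetP[_ /imsetP[u _ ->] ->]; apply/bigcupP.
  exists (val u).1 => //; rewrite wreath_expE; apply: imset_f.
  by apply/imsetP; exists (val u).2.
apply: leq_trans (subset_leq_card sub) _.
have le_bigcup : (#|\bigcup_(w : gT) [set (w ^+ p, h)%g | h in N w]| <=
    \sum_(w : gT) #|N w|)%N.
  elim/big_rec2: _ => [|w n A _ leA]; first by rewrite cards0.
  by rewrite (leq_trans (leq_card_setU _ _)) // leq_add // leq_imset_card.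
apply: leq_trans le_bigcup _; rewrite -sum_nat_const leq_sum // => w _.
exact: card_sum_grpalg_act.
Qed.

End Wreath.

(** * Order and exponent of W_k, and the count in G_k *)

Section IteratedWreath.
Variables p k : nat.
Hypotheses (p_prime : prime p) (k_gt0 : 0 < k).

Lemma card_Zpk : #|'Z_(p ^ k)| = p ^ k.
Proof.
by rewrite card_ord Zp_cast // -[1%N](expn0 p) ltn_exp2l ?prime_gt1.
Qed.

(** Factored as [p ^ e * q] with [e = k.+1], the exponent bound of [expg_W]; this [q] is the power
    of p in the final estimate. *)
Lemma card_W : #|W p k| = p ^ k.+1 * p ^ (p ^ k - 1).
Proof.
rewrite card_wreath // card_Zpk -!expnD addSnnS -addn1 subnK //.
by rewrite expn_gt0 prime_gt0.
Qed.

(** The [p ^ k]-th power has trivial cyclic component, so it lies in the additive group of the group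
    algebra, which is killed by p. *)
Lemma expg_W (u : W p k) : (u ^+ (p ^ k.+1) = 1)%g.
Proof.
rewrite expnSr expgM; set v := (u ^+ (p ^ k))%g.
have v1 : (val v).1 = 1%g.
  have := expg_cardG (in_setT (val u).1); rewrite cardsT card_Zpk => u1.
  by rewrite wreath_expE.
apply: val_inj; rewrite wreath_expE v1 expg1n; congr (_, _).
apply/ffunP=> y; rewrite sum_ffunE (eq_bigr (fun=> (val v).2 y)) => [|i _].
  by rewrite sumr_const card_ord -mulr_natr pchar_Fp_0 // mulr0 ffunE.
by rewrite grpalg_actE expg1n mul1g.
Qed.

Lemma card_pthpowers_G :
  #|pthpowers p (G p k)| * p ^ ((p - 1) * p ^ (p ^ k - 1)) <= #|G p k|.
Proof.
have pk : p.-1 <= p ^ k.+1.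
  apply: leq_trans (leq_pred p) _; rewrite expnS leq_pmulr //.
  by rewrite expn_gt0 prime_gt0.
apply: leq_trans (leq_mul (card_pthpowers_wreath p_prime card_W expg_W pk)
  (leqnn _)) _.
rewrite [#|G p k|](@card_wreath p (W p k) p_prime) -mulnA -expnD -subn1.
rewrite [X in _ + X]mulnC -mulnDr subnK; last by rewrite subn1.
by rewrite [X in _ <= _ * _ ^ X]card_W mulnC [X in _ ^ X]mulnC mulnC.
Qed.

End IteratedWreath.

Local Open Scope classical_set_scope.
Local Open Scope ring_scope.

(** * The proportion and its limit *)

Section Limit.
Variables (R : realType) (p : nat).
Hypothesis p_prime : prime p.

Lemma pthpower_proportion_G_le k : (1 <= k)%N ->
  pthpower_proportion R p (G p k) <= p%:R ^- ((p - 1) * p ^ (p ^ k - 1))%N.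
Proof.
move=> k_gt0; rewrite /pthpower_proportion ler_pdivrMr; last first.
  by rewrite ltr0n; apply/card_gt0P; exists 1%g.
rewrite mulrC ler_pdivlMr ?exprn_gt0 ?ltr0n ?prime_gt0 // -natrX -natrM ler_nat.
exact: card_pthpowers_G.
Qed.

Lemma pthpower_proportion_G_cvg :
  pthpower_proportion R p (G p k) @[k --> \oo] --> (0 : R).
Proof.
have p_gt1 := prime_gt1 p_prime; have p_gt0 := ltnW p_gt1.
have pR_gt0 : 0 < p%:R :> R by rewrite ltr0n.
have p1 : `|(p%:R : R)^-1| < 1.
  by rewrite ger0_norm ?invr_ge0 ?ler0n // invf_lt1 ?ltr1n // ltr0n ltnW.
(* Squeeze between 0 and p^-k: for k >= 1 the exponent (p-1) p^(p^k-1) is at least p^(p^k-1) > p^k -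
   1 >= k. *)
apply: (squeeze_cvgr _ (cvg_cst 0) (cvg_expr p1)).
near=> k; apply/andP; split; first by rewrite divr_ge0 ?ler0n.
have k_gt0 : (1 <= k)%N by near: k; exists 1%N.
apply: le_trans (pthpower_proportion_G_le k_gt0) _.
rewrite exprVn lef_pV2 ?posrE; first last.
- exact: exprn_gt0.
- exact: exprn_gt0.
rewrite ler_eXn2l ?ltr1n //; apply: leq_trans (leq_pmull _ _); last first.
  by rewrite subn_gt0.
have kpk : (k <= p ^ k - 1)%N.
  by rewrite leq_subRL ?expn_gt0 ?p_gt0 // add1n ltn_expl.
exact/(leq_trans kpk)/ltnW/ltn_expl.
Unshelve. all: by end_near. Qed.

End Limit.

Theorem mainTheorem18 (R : realType) (p : nat) (p_prime : prime p) :
  (forall k : nat, (1 <= k)%N ->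
    pthpower_proportion R p (G p k) <= p%:R ^- ((p - 1) * p ^ (p ^ k - 1))%N)
  /\ (pthpower_proportion R p (G p k) @[k --> \oo] --> (0 : R)).
Proof.
split; first exact: pthpower_proportion_G_le.
exact: pthpower_proportion_G_cvg.
Qed.
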